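(* Let $d\in\mathbb{N}$ (so $d\geq 1$). For real $H\geq 1$ let $M_d(H)$ denote the number of $\mathbf{a}=(a_1,a_2,a_3,a_4)\in\mathbb{Z}^4$ with $|a_i|\leq H$ for $i=1,2,3,4$ such that the equation $$a_1x_1^d+a_2x_2^d+a_3x_3^d+a_4x_4^d=0$$ is everywhere locally soluble. Then there exists a constant $c(d)>0$, depending only on $d$, such that for all real $H\geq 1$, $$M_d(H)\geq c(d)\,H^4.$$
   Context: The equation $a_1x_1^d+\cdots+a_4x_4^d=0$ is called everywhere locally soluble if it has a solution $(x_1,x_2,x_3,x_4)\neq(0,0,0,0)$ in $\mathbb{R}^4$ and, for every prime $p$, a solution $(x_1,x_2,x_3,x_4)\neq(0,0,0,0)$ in $\mathbb{Q}_p^4$. *)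

(* Defs.v *)
From HB Require Import structures.
From mathcomp Require Import all_boot all_order all_algebra.
From mathcomp Require Import finmap zify.
From mathcomp Require Import boolp classical_sets cardinality reals.

Set Implicit Arguments.
Unset Strict Implicit.
Unset Printing Implicit Defensive.

Import Order.TTheory GRing.Theory Num.Theory.

Local Open Scope classical_set_scope.
Local Open Scope ring_scope.

(* The ring Z_p as the inverse limit of the rings Z/p^n: the component at n is
   the canonical representative, in {0, ..., p^n - 1}, of a class modulo p^n
   (being a remainder modulo p^n, it lies in that range). *)
Record padic_int (p : nat) (p_pr : prime p) := PadicInt {
  padic_val :> nat -> int;
  padic_valP : forall n, padic_val n = (padic_val n.+1 %% p%:Z ^+ n)%Z
}.

Section PadicIntRing.
Variables (p : nat) (p_pr : prime p).
Local Notation Zp := (padic_int p_pr).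
Implicit Types x y z : Zp.

HB.instance Definition _ := gen_eqMixin Zp.
HB.instance Definition _ := gen_choiceMixin Zp.

Lemma padic_int_eq x y : (forall n, x n = y n) -> x = y.
Proof.
case: x y => [x xP] [y yP] /= /funext xy; subst y.
by congr PadicInt; exact: Prop_irrelevance.
Qed.

Lemma padic_modS x n : (x n.+1 = x n %[mod p%:Z ^+ n])%Z.
Proof. by rewrite [x n in RHS]padic_valP modz_mod. Qed.

Lemma padic_modn x n : (x n %% p%:Z ^+ n)%Z = x n.
Proof. by rewrite [x n in LHS]padic_valP modz_mod -padic_valP. Qed.

Lemma modz_expS (a b : int) n :
  (a = b %[mod p%:Z ^+ n.+1])%Z -> (a = b %[mod p%:Z ^+ n])%Z.
Proof.
move=> /eqP; rewrite eqz_mod_dvd => ab; apply/eqP; rewrite eqz_mod_dvd.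
by apply: dvdz_trans ab; apply: dvdz_exp2l.
Qed.

Lemma padic_mod_le x n m : (n <= m)%N -> (x m = x n %[mod p%:Z ^+ n])%Z.
Proof.
elim: m => [|m IHm]; first by rewrite leqn0 => /eqP->.
rewrite leq_eqVlt => /predU1P[<-//|]; rewrite ltnS => nm; rewrite -(IHm nm).
have /eqP := padic_modS x m; rewrite eqz_mod_dvd => h.
apply/eqP; rewrite eqz_mod_dvd; apply: dvdz_trans h.
exact: dvdz_exp2l.
Qed.

Fact coherent_subproof (u : nat -> int) :
  (forall n, (u n.+1 = u n %[mod p%:Z ^+ n])%Z) ->
  forall n, (u n %% p%:Z ^+ n)%Z = ((u n.+1 %% p%:Z ^+ n.+1)%Z %% p%:Z ^+ n)%Z.
Proof. by move=> uP n; rewrite -uP; apply/esym/modz_expS; rewrite modz_mod. Qed.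

Definition padic_of_seq (u : nat -> int)
    (uP : forall n, (u n.+1 = u n %[mod p%:Z ^+ n])%Z) : Zp :=
  PadicInt p_pr (coherent_subproof uP).

Definition padic_int_of_int (a : int) : Zp :=
  padic_of_seq (fun n => erefl (a %% p%:Z ^+ n)%Z).

Fact padic_add_subproof x y n :
  (x n.+1 + y n.+1 = x n + y n %[mod p%:Z ^+ n])%Z.
Proof. by rewrite -modzDm !padic_modS modzDm. Qed.

Fact padic_opp_subproof x n : (- x n.+1 = - x n %[mod p%:Z ^+ n])%Z.
Proof. by rewrite -modzNm padic_modS modzNm. Qed.

Fact padic_mul_subproof x y n :
  (x n.+1 * y n.+1 = x n * y n %[mod p%:Z ^+ n])%Z.
Proof. by rewrite -modzMm !padic_modS modzMm. Qed.

Definition padic_add x y : Zp := padic_of_seq (padic_add_subproof x y).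
Definition padic_opp x : Zp := padic_of_seq (padic_opp_subproof x).
Definition padic_mul x y : Zp := padic_of_seq (padic_mul_subproof x y).

Fact padic_addA : associative padic_add.
Proof. by move=> x y z; apply: padic_int_eq => n /=; rewrite modzDmr modzDml addrA. Qed.

Fact padic_addC : commutative padic_add.
Proof. by move=> x y; apply: padic_int_eq => n /=; rewrite addrC. Qed.

Fact padic_add0 : left_id (padic_int_of_int 0) padic_add.
Proof. by move=> x; apply: padic_int_eq => n /=; rewrite modzDml add0r padic_modn. Qed.

Fact padic_addN : left_inverse (padic_int_of_int 0) padic_opp padic_add.
Proof. by move=> x; apply: padic_int_eq => n /=; rewrite modzDml addNr. Qed.

HB.instance Definition _ :=
  GRing.isZmodule.Build Zp padic_addA padic_addC padic_add0 padic_addN.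

Fact padic_mulA : associative padic_mul.
Proof. by move=> x y z; apply: padic_int_eq => n /=; rewrite modzMmr modzMml mulrA. Qed.

Fact padic_mulC : commutative padic_mul.
Proof. by move=> x y; apply: padic_int_eq => n /=; rewrite mulrC. Qed.

Fact padic_mul1 : left_id (padic_int_of_int 1) padic_mul.
Proof. by move=> x; apply: padic_int_eq => n /=; rewrite modzMml mul1r padic_modn. Qed.

Fact padic_mulDl : left_distributive padic_mul padic_add.
Proof.
by move=> x y z; apply: padic_int_eq => n /=; rewrite modzMml mulrDl modzDm.
Qed.

Fact padic_oner_neq0 : padic_int_of_int 1 != 0 :> Zp.
Proof.
apply/eqP => /(congr1 (fun x : Zp => x 1%N)) /=.
by rewrite expr1 mod0z modz_small // ltz_nat prime_gt1.
Qed.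

HB.instance Definition _ := GRing.Zmodule_isComNzRing.Build Zp
  padic_mulA padic_mulC padic_mul1 padic_mulDl padic_oner_neq0.

Definition padic_unit : pred Zp := fun x => `[< exists y, y * x = 1 >].
Definition padic_inv x : Zp :=
  if pselect (exists y, y * x = 1) is left e then projT1 (cid e) else x.

Fact padic_mulVx : {in padic_unit, left_inverse 1 padic_inv *%R}.
Proof.
move=> x /asboolP xu; rewrite /padic_inv; case: pselect => // e.
by case: cid.
Qed.

Fact padic_unitP x y : y * x = 1 -> x \in padic_unit.
Proof. by move=> yx; apply/asboolP; exists y. Qed.

Fact padic_invx_out : {in [predC padic_unit], padic_inv =1 id}.
Proof.
move=> x /negP xu; rewrite /padic_inv; case: pselect => // e.
by case: xu; apply/asboolP.
Qed.

HB.instance Definition _ := GRing.ComNzRing_hasMulInverse.Build Zp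
  padic_mulVx padic_unitP padic_invx_out.

Lemma padic_neq0 x : x != 0 -> exists n, ~~ (p%:Z ^+ n %| x n)%Z.
Proof.
move=> x0; apply: contrapT => /forallNP xn; case/eqP: x0.
apply: padic_int_eq => n /=; rewrite mod0z -padic_modn; apply/dvdz_mod0P.
by apply: contrapT => /negP; exact: xn.
Qed.

Fact padic_mulf_eq0 x y : x * y = 0 -> (x == 0) || (y == 0).
Proof.
move=> xy0; apply: contrapT => /negP; rewrite negb_or => /andP[].
move=> /padic_neq0[n xn] /padic_neq0[m ym].
have {}xn : ~~ (p%:Z ^+ n %| x (n + m)%N)%Z.
  apply: contra xn => /dvdz_mod0P h; apply/dvdz_mod0P.
  by rewrite -(padic_mod_le x (leq_addr m n)).
have {}ym : ~~ (p%:Z ^+ m %| y (n + m)%N)%Z.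
  apply: contra ym => /dvdz_mod0P h; apply/dvdz_mod0P.
  by rewrite -(padic_mod_le y (leq_addl n m)).
have : (p%:Z ^+ (n + m) %| x (n + m)%N * y (n + m)%N)%Z.
  by apply/dvdz_mod0P; move: (congr1 (fun z : Zp => z (n + m)%N) xy0); rewrite /= mod0z.
move: xn ym; rewrite !dvdzE !abszX !absz_nat abszM.
case: (posnP `|x (n + m)|%N) => [->|x0]; first by rewrite dvdn0.
case: (posnP `|y (n + m)|%N) => [->|y0]; first by rewrite dvdn0.
rewrite !pfactor_dvdn ?muln_gt0 ?x0 ?y0 // lognM // -!ltnNge => xn ym.
by rewrite leqNgt -addnS leq_add // ltnW.
Qed.

HB.instance Definition _ :=
  GRing.ComUnitRing_isIntegral.Build Zp padic_mulf_eq0.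

End PadicIntRing.

Notation padic p_pr := {fraction (padic_int p_pr)}.

Definition soluble_over (K : fieldType) (d : nat) (a : 'rV[int]_4) : Prop :=
  exists2 x : 'rV[K]_4, x != 0 & \sum_(i < 4) (a 0 i)%:~R * x 0 i ^+ d = 0.

Definition everywhere_locally_soluble (R : realType) (d : nat)
    (a : 'rV[int]_4) : Prop :=
  soluble_over R d a /\
  forall (p : nat) (p_pr : prime p), soluble_over (padic p_pr) d a.

Definition soluble_coeffs (R : realType) (d : nat) (H : R) : set 'rV[int]_4 :=
  [set a : 'rV[int]_4 |
    (forall i, `|a 0 i|%:~R <= H) /\
    everywhere_locally_soluble R d a].

(* fset_set sends an infinite set to fset0, so that M_ below counts correctly only
   because the set counted is finite. *)
Lemma soluble_coeffs_finite (R : realType) (d : nat) (H : R) :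
  finite_set (soluble_coeffs d H).
Proof.
pose n := Num.truncn H.
pose f (b : 'rV['I_(n + n).+1]_4) : 'rV[int]_4 :=
  \row_i ((b 0 i : nat)%:Z - n%:Z).
apply: (@sub_finite_set _ _ (f @` [set: 'rV['I_(n + n).+1]_4])); last first.
  by apply: finite_image; exact: finite_finset.
move=> a [aH _].
have an i : (absz (a 0%R i) <= n)%N.
  have := aH i; rewrite -abszE -pmulrn => aHi; rewrite truncn_ge_nat //.
  exact: le_trans aHi.
exists (\row_i inord (absz (a 0 i + n%:Z))) => //.
apply/rowP => i; rewrite !mxE inordK; have := an i; lia.
Qed.

Definition M_ (R : realType) (d : nat) (H : R) : nat :=
  #|` fset_set (soluble_coeffs d H)|%fset.

(* Main.v *)
Require Import Defs.
From mathcomp Require Import finmap boolp classical_sets cardinality.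
From mathcomp Require Import all_boot all_order all_algebra reals.
From mathcomp Require Import ring zify.

Import Order.TTheory GRing.Theory Num.Theory.
Local Open Scope ring_scope.

(** A positive proportion of the coefficient vectors is exhibited explicitly.
    Put P = 256 d^4 and Q = d^2 P!, and consider the vectors whose entries are
    Q m_i + 1 with 0 <= m_i < N = floor (H / Q), up to a sign that is negative
    in one place only.  Such a vector is soluble over the reals, because two of
    its entries have opposite signs.

    If p <= P, two entries are 1 and -1 modulo Q, so (1, 1, 0, 0) is a solution
    modulo p^(2 v_p(d) + 1); Newton's method (hensel_diagonal) turns it into a
    p-adic solution.  If p > P, then p does not divide d, and three entries that
    are units modulo p suffice: by diagonal_ternary_soluble a ternary diagonal
    equation of degree d has a zero modulo p as soon as p > 16 d^4, and this zero
    lifts.  Instead of Weil's bound or Gauss sums, that lemma uses incidences: a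
    zero is an incidence between a point and a line of the affine plane, where
    the points and the lines are both parametrised by pairs of nonzero d-th
    powers, and card_no_incidence says that so many points and lines cannot avoid
    each other.

    Hence every vector with pairwise coprime entries is everywhere locally
    soluble.  An entry is prime to every p <= P, so two entries fail to be coprime
    only if a prime p > P divides both, which, when the indices m_i and m_j
    differ, forces p to divide m_i - m_j, hence p < N.  Each such p accounts for a
    proportion O(1/p^2) of the pairs, the sum over p > P is O(1/P), and the pairs
    with m_i = m_j are a proportion 1/N: with the above P and N >= 64, at least
    half of the N^4 vectors remain (card_pairwise_coprime_tuples).  For H below
    a constant multiple of Q it is enough that the zero vector is counted. *)

(** * Incidences and ternary equations over finite fields *)

(** Lines avoiding the origin are encoded by their coefficients, which makes
    points and lines symmetric. *)
Definition on_line (F : finFieldType) (l z : F * F) : bool :=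
  l.1 * z.1 + l.2 * z.2 == 1.

Lemma card_line (F : finFieldType) (l : F * F) :
  l.1 != 0 -> (\sum_z on_line F l z)%N = #|F|.
Proof.
move=> l1.
rewrite -(pair_big xpredT xpredT (fun u v => nat_of_bool (on_line F l (u, v)))) /=.
rewrite exchange_big /= -sum1_card; apply: eq_bigr => v _.
rewrite (bigD1 ((1 - l.2 * v) / l.1)) //= big1 /on_line /= ?addn0.
  by rewrite mulrC divfK // subrK eqxx.
move=> u; apply: contraNeq; rewrite eqb0 negbK => /eqP <-.
by rewrite addrK mulrC mulKf.
Qed.

Lemma card_line_meet_le1 (F : finFieldType) (l m : F * F) :
  l != m -> (\sum_z on_line F l z * on_line F m z <= 1)%N.
Proof.
move=> lm.
case: (pickP (fun z => on_line F l z && on_line F m z)) => [z /andP[lz mz]|none].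
  2: by rewrite big1 // => z _; rewrite mulnb none.
rewrite (bigD1 z) //= lz mz big1 // => w wz; rewrite mulnb; apply/eqP.
rewrite eqb0; apply: contra lm => /andP[].
move: lz mz wz; rewrite /on_line.
case: l m z w => [l1 l2] [m1 m2] [z1 z2] [w1 w2] /=.
move=> /eqP lz /eqP mz wz /eqP lw /eqP mw.
(* By Cramer's rule the coefficients of a line through z and w are determined if
   their determinant D is nonzero, and D = 0 forces z = w. *)
pose D := z1 * w2 - z2 * w1.
have cramer1 a b : a * z1 + b * z2 = 1 -> a * w1 + b * w2 = 1 ->
    a * D = w2 - z2.
  move=> az aw; transitivity (w2 * (a * z1 + b * z2) - z2 * (a * w1 + b * w2)).
    by rewrite /D; ring.
  by rewrite az aw !mulr1.
have cramer2 a b : a * z1 + b * z2 = 1 -> a * w1 + b * w2 = 1 ->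
    b * D = z1 - w1.
  move=> az aw; transitivity (z1 * (a * w1 + b * w2) - w1 * (a * z1 + b * z2)).
    by rewrite /D; ring.
  by rewrite az aw !mulr1.
have D0 : D != 0.
  apply: contra wz => /eqP D0; have := cramer1 _ _ lz lw.
  have := cramer2 _ _ lz lw; rewrite D0 !mulr0.
  by move=> /esym/eqP; rewrite subr_eq0 => /eqP-> /esym/eqP; rewrite subr_eq0 => /eqP->.
apply/eqP; congr pair; apply: (mulIf D0).
  by rewrite (cramer1 _ _ lz lw) (cramer1 _ _ mz mw).
by rewrite (cramer2 _ _ lz lw) (cramer2 _ _ mz mw).
Qed.

(** A second moment argument: on average a point of the plane lies on
    |L| / |F| lines of L, and since two lines meet at most once the squared
    deviations from this mean add up to at most |F| |L|.  A point on no line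
    contributes (|L| / |F|)^2 to the sum, so there are few such points. *)
Lemma card_no_incidence (F : finFieldType) (L P : {set F * F}) :
  {in L, forall l, l.1 != 0} ->
  {in L & P, forall l z, ~~ on_line F l z} ->
  (#|P| * #|L| <= #|F| ^ 3)%N.
Proof.
move=> L0 LP; pose deg z := (\sum_(l in L) on_line F l z)%N.
have deg_P z : z \in P -> deg z = 0%N.
  by move=> zP; apply: big1 => l lL; apply/eqP; rewrite eqb0 LP.
have sum_deg : (\sum_z deg z = #|F| * #|L|)%N.
  rewrite exchange_big /= (eq_bigr (fun=> #|F|)) ?sum_nat_const 1?mulnC //.
  by move=> l lL; rewrite card_line ?L0.
have sum_deg2 : (\sum_z deg z ^ 2 <= #|F| * #|L| + #|L| ^ 2)%N.
  have -> : (\sum_z deg z ^ 2 =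
      \sum_(l in L) \sum_(m in L) \sum_z on_line F l z * on_line F m z)%N.
    under [RHS]eq_bigr => l _ do rewrite exchange_big /=.
    rewrite exchange_big /=; apply: eq_bigr => z _.
    rewrite -mulnn big_distrl /=; apply: eq_bigr => l _.
    by rewrite big_distrr.
  apply: (@leq_trans (\sum_(l in L) (#|F| + #|L|))%N).
    apply: leq_sum => l lL; rewrite (bigD1 l) //= leq_add //.
      rewrite -(card_line F l (L0 l lL)); apply: leq_sum => z _.
      by case: on_line.
    rewrite -sum1_card [leqRHS](bigD1 l) //= ltnW // ltnS.
    by apply: leq_sum => m /andP[_ lm]; apply: card_line_meet_le1; rewrite eq_sym.
  by rewrite sum_nat_const mulnDr mulnC mulnn.
have [->|L_gt0] := posnP #|L|; first by rewrite muln0.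
(* This is (|F| deg z - |L|)^2 >= 0, or the equality |L|^2 when z is in P, with
   the negative term moved to the left to stay in the natural numbers. *)
have var z : (2 * (#|F| * #|L|) * deg z + (z \in P) * #|L| ^ 2
    <= #|F| ^ 2 * deg z ^ 2 + #|L| ^ 2)%N.
  case: (boolP (z \in P)) => [/deg_P->|_]; first by rewrite -!mulnn; nia.
  by have := (nat_Cauchy (#|F| * deg z) #|L|).1; rewrite -!mulnn; nia.
have := leq_sum (index_enum (F * F)%type) (P := xpredT) (fun z _ => var z).
rewrite !big_split /= -!big_distrr -big_distrl /= sum_deg.
rewrite sum_nat_const card_prod -big_mkcond /= sum1_card => le_var.
rewrite -(leq_pmul2r L_gt0).
have := leq_mul (leqnn (#|F| ^ 2)) sum_deg2.
have arith q l m s : (q ^ 2 * s <= q ^ 2 * (q * l + l ^ 2) ->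
    2 * (q * l) * (q * l) + m * l ^ 2 <= q ^ 2 * s + l * (q * q * l) ->
    m * l * l <= q ^ 3 * l)%N.
  by rewrite !expnS !expn0 !muln1; nia.
by move=> le_deg2; exact: (arith _ _ _ _ le_deg2 le_var).
Qed.

Definition unit_powers (F : finFieldType) (d : nat) : {set F} :=
  [set x ^+ d | x in [set~ 0]].

Lemma unit_powersM (F : finFieldType) d :
  {in unit_powers F d &, forall u v, u * v \in unit_powers F d}.
Proof.
move=> _ _ /imsetP[x x0 ->] /imsetP[y y0 ->].
by apply/imsetP; exists (x * y); rewrite ?exprMn // !inE mulf_neq0 // -?in_setC1.
Qed.

(** Every fibre of the d-th power map is the root set of a polynomial of degree
    d. *)
Lemma card_unit_powers (F : finFieldType) d :
  (0 < d)%N -> (#|F| <= d * #|unit_powers F d| + 1)%N.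
Proof.
move=> d_gt0; rewrite -cardsT (cardsD1 0) inE addnC leq_add2r.
have -> : [set: F] :\ 0 = [set~ 0] by apply/setP => x; rewrite !inE andbT.
rewrite -sum1_card (partition_big_imset (fun x => x ^+ d)) /=.
apply: (@leq_trans (\sum_(z in unit_powers F d) d)%N); last first.
  by rewrite sum_nat_const mulnC.
apply: leq_sum => z _; rewrite sum1dep_card cardE -ltnS -(size_XnsubC z d_gt0).
apply: max_poly_roots; rewrite ?enum_uniq //.
  by rewrite -size_poly_gt0 size_XnsubC.
apply/allP => x; rewrite mem_enum inE => /andP[_ /eqP <-].
by rewrite /root !hornerE subrr.
Qed.

(** Let A be the group of nonzero d-th powers.  As A is closed under products,
    if the point (u, v) of A x A lies on the line with coefficients
    (- (a / c) g, - (b / c) h), with g and h in A, then g u and h v are d-th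
    powers that solve the equation.  Without incidences |A|^4 <= |F|^3, while
    |A| >= (|F| - 1) / d. *)
Lemma diagonal_ternary_soluble (F : finFieldType) d (a b c : F) :
    (0 < d)%N -> (16 * d ^ 4 < #|F|)%N -> a != 0 -> b != 0 -> c != 0 ->
  exists x y, x != 0 /\ a * x ^+ d + b * y ^+ d + c = 0.
Proof.
move=> d_gt0 dF a0 b0 c0; set A := unit_powers F d.
pose P := setX A A.
pose L := setX [set - (a / c) * g | g in A] [set - (b / c) * h | h in A].
have ac0 : - (a / c) != 0 by rewrite oppr_eq0 mulf_neq0 ?invr_eq0.
have bc0 : - (b / c) != 0 by rewrite oppr_eq0 mulf_neq0 ?invr_eq0.
case: (pickP (fun lz : (F * F) * (F * F) =>
    [&& lz.1 \in L, lz.2 \in P & on_line F lz.1 lz.2])) => [[l z] /= | none].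
  case: l z => [_ _] [u v] /= /and3P[/setXP[/imsetP[g gA ->] /imsetP[h hA ->]]].
  move=> /setXP[/= uA vA]; rewrite /on_line /=.
  have /imsetP[x x0 guE] := unit_powersM F d _ _ gA uA.
  have /imsetP[y _ hvE] := unit_powersM F d _ _ hA vA.
  rewrite -!mulrA guE hvE => /eqP luz; exists x, y; split.
    by rewrite !inE in x0.
  apply/eqP; rewrite addrC addr_eq0; apply/eqP.
  by rewrite -[c in LHS]mulr1 -luz; field.
have L0 : {in L, forall l, l.1 != 0}.
  case=> l1 l2 /setXP[/imsetP[_ /imsetP[x x0 ->] ->] _] /=.
  by rewrite mulf_neq0 // expf_neq0 // -in_setC1.
have cardsA k : k != 0 -> #|[set k * g | g in A]| = #|A|.
  by move=> k0; apply: card_imset; apply: mulfI.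
have A_small : (#|P| * #|L| <= #|F| ^ 3)%N.
  apply: card_no_incidence L0 _ => l z lL zP.
  by apply/negP => lz; have := none (l, z); rewrite /= lL zP lz.
rewrite !cardsX !cardsA // in A_small.
have := card_unit_powers F d d_gt0; rewrite -/A => A_big.
have d4_gt0 : (0 < d ^ 4)%N by rewrite expn_gt0 d_gt0.
have F_gt0 : (0 < #|F|)%N by lia.
have F_le : (#|F| <= 2 * (d * #|A|))%N by lia.
have F4 : (#|F| ^ 4 <= 16 * d ^ 4 * #|F| ^ 3)%N.
  have A4 : (#|A| ^ 4 <= #|F| ^ 3)%N.
    by apply: leq_trans A_small; rewrite !expnS expn0 muln1 !mulnA.
  apply: leq_trans (leq_mul (leqnn _) A4).
  by rewrite (_ : 16 = 2 ^ 4)%N // -!expnMn leq_exp2r // -mulnA.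
by move: F4; rewrite expnS leq_pmul2r ?expn_gt0 ?F_gt0 // leqNgt dF.
Qed.

(** * Hensel lifting of diagonal equations *)

Lemma exprD_mod_sqr (R : comNzRingType) (x h : R) d :
  exists r, (x + h) ^+ d = x ^+ d + d%:R * x ^+ d.-1 * h + r * h ^+ 2.
Proof.
elim: d => [|d [r IHd]]; first by exists 0; rewrite !expr0; ring.
exists (d%:R * x ^+ d.-1 + r * (x + h)); rewrite exprS IHd.
case: d {IHd} => [|d] /=; first by rewrite !expr0 expr1; ring.
by rewrite !exprS [d.+2%:R]mulrS [d.+1%:R]mulrS; ring.
Qed.

(** One step of Newton's method when p may divide the derivative d y^(d-1): with
    e = v_p(d), moving y by a multiple t p^(n-e) changes y^d, to first order, by
    p^n times a number that takes all values modulo p as t varies, and the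
    quadratic error is divisible by p^(2(n-e)), hence by p^(n+1) as 2 e < n. *)
Lemma hensel_step (p d n : nat) (c u y : int) :
    prime p -> (0 < d)%N -> ((logn p d).*2 < n)%N ->
    ~~ (p %| c)%Z -> ~~ (p %| y)%Z -> (p%:Z ^+ n %| c * y ^+ d - u)%Z ->
  exists y' : int, [/\ ~~ (p %| y')%Z, (p%:Z ^+ n.+1 %| c * y' ^+ d - u)%Z
    & (p%:Z ^+ (n - logn p d) %| y' - y)%Z].
Proof.
move=> p_pr d_gt0 en pc py /dvdzP[k ck].
have [m pm dE] := pfactor_coprime p_pr d_gt0; set e := logn p d in en dE *.
have pX (z : int) : ~~ (p %| z)%Z = coprimez p z.
  by rewrite coprimezE dvdzE absz_nat prime_coprime.
have /coprimezP[[s t] /= st] : coprimez p (c * (m%:Z * y ^+ d.-1)).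
  by rewrite !coprimezMr coprimezXr -?pX // pc dvdzE !absz_nat -prime_coprime // pm.
have e_lt_n : (e < n)%N by apply: leq_ltn_trans en; rewrite -addnn leq_addr.
have ne : (n - e = (n - e).-1.+1)%N by rewrite prednK // subn_gt0.
(* k is the defect c y^d - u divided by p^n, and t inverts the unit part of the
   derivative modulo p, so that this shift cancels the defect. *)
pose h : int := - (k * t) * p%:Z ^+ (n - e).
exists (y + h); split; last by rewrite addrC addKr dvdz_mull.
  apply: contra py => pyh.
  have : (p %| h)%Z by rewrite /h ne exprS dvdz_mull // dvdz_mulr.
  by move=> ph; rewrite -[y](addrK h) rpredB.
have [r ->] := exprD_mod_sqr int y h d.
have dh : d%:R * h = - (k * t * m%:Z) * p%:Z ^+ n.
  rewrite /h [in LHS]dE natrM natrX -[in RHS](subnK (ltnW e_lt_n)) exprD.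
  by rewrite !natz; ring.
have hh : (p%:Z ^+ n.+1 %| h ^+ 2)%Z.
  rewrite /h exprMn -exprM dvdz_mull // dvdz_exp2l //.
  by rewrite muln2 doubleB -addnn ltn_subRL ltn_add2r.
have -> : c * (y ^+ d + d%:R * y ^+ d.-1 * h + r * h ^+ 2) - u
    = (c * y ^+ d - u) + c * y ^+ d.-1 * (d%:R * h) + c * r * h ^+ 2 by ring.
rewrite dh ck rpredD //; last by apply: dvdz_mull.
apply/dvdzP; exists (k * s); rewrite exprS.
transitivity (k * p%:Z ^+ n * (1 - t * (c * (m%:Z * y ^+ d.-1)))); first by ring.
by rewrite -st; ring.
Qed.

Lemma padic_intr p (p_pr : prime p) (a : int) n :
  (a%:~R : padic_int p_pr) n = (a %% p%:Z ^+ n)%Z.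
Proof.
have nat_case (m : nat) : (m%:R : padic_int p_pr) n = (m%:Z %% p%:Z ^+ n)%Z.
  elim: m => [//|m IHm].
  by rewrite mulrS /= IHm modzDm -intS.
case: a => m; first exact: nat_case.
by rewrite NegzE mulrNz /= -pmulrn nat_case modzNm.
Qed.

Lemma padic_exp p (p_pr : prime p) (x : padic_int p_pr) k n :
  (x ^+ k) n = (x n ^+ k %% p%:Z ^+ n)%Z.
Proof. by elim: k => [//|k IHk]; rewrite exprS /= IHk modzMmr -exprS. Qed.

(** The approximate roots produced by hensel_step, valid modulo
    p^(n + 2e + 1) with e = v_p(d), are moved by a multiple of p^(n + e + 1) at
    each step, so they are coherent modulo p^n and define a p-adic integer. *)
Lemma hensel_diagonal (p d : nat) (p_pr : prime p) (c u y : int) :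
    (0 < d)%N -> ~~ (p %| c)%Z -> ~~ (p %| y)%Z ->
    (p%:Z ^+ (logn p d).*2.+1 %| c * y ^+ d - u)%Z ->
  exists Y : padic_int p_pr, c%:~R * Y ^+ d = u%:~R.
Proof.
move=> d_gt0 pc py0 cy0; set e := logn p d in cy0.
pose good n (z : int) := ~~ (p %| z)%Z /\ (p%:Z ^+ (n + e.*2.+1) %| c * z ^+ d - u)%Z.
have /choice[next nextP] (nz : nat * int) : exists z' : int, good nz.1 nz.2 ->
    good nz.1.+1 z' /\ (p%:Z ^+ nz.1 %| z' - nz.2)%Z.
  case: nz => n z /=.
  have [[pz cz]|] := pselect (good n z); last by exists 0.
  have en : ((logn p d).*2 < n + e.*2.+1)%N by rewrite -/e addnS ltnS leq_addl.
  have le_n : (n <= n + e.*2.+1 - e)%N.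
    by rewrite -addnBA ?leq_addr // leqW // -addnn leq_addr.
  have [z' [pz' cz' zz']] := hensel_step p d _ c u z p_pr d_gt0 en pc pz cz.
  exists z' => _; split; first exact: (conj pz' cz').
  exact: dvdz_trans (dvdz_exp2l p%:Z le_n) zz'.
pose s := fix s n := if n is n'.+1 then next (n', s n') else y.
have s_good n : good n (s n).
  by elim: n => [|n IHn] //; have [] := nextP (n, s n) IHn.
have s_coherent n : (s n.+1 = s n %[mod p%:Z ^+ n])%Z.
  by apply/eqP; rewrite eqz_mod_dvd; have [] := nextP (n, s n) (s_good n).
exists (padic_of_seq p_pr s_coherent); apply: padic_int_eq => n.
rewrite padic_intr /= padic_intr padic_exp /= modzXm modzMm.
apply/eqP; rewrite eqz_mod_dvd; have [_] := s_good n; apply: dvdz_trans.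
exact/dvdz_exp2l/leq_addr.
Qed.

(** * Local solubility criteria *)

(** All coordinates except i keep their integer values and coordinate i is
    lifted; it stays nonzero because a_i w_i^d is a unit modulo p. *)
Lemma soluble_padic_of_mod (p d : nat) (p_pr : prime p) (a : 'rV[int]_4)
    (w : 'I_4 -> int) (i : 'I_4) :
    (0 < d)%N -> ~~ (p %| a 0%R i)%Z -> ~~ (p %| w i)%Z ->
    (p%:Z ^+ (logn p d).*2.+1 %| (\sum_j a 0 j * w j ^+ d)%R)%Z ->
  soluble_over (padic p_pr) d a.
Proof.
move=> d_gt0 pai pwi sum_w.
pose u := - \sum_(j | j != i) a 0 j * w j ^+ d.
have uE : a 0 i * w i ^+ d - u = \sum_j a 0 j * w j ^+ d.
  by rewrite opprK [RHS](bigD1 i).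
have uw := sum_w; rewrite -uE in uw.
have [Y Yu] := hensel_diagonal p d p_pr _ _ _ d_gt0 pai pwi uw.
pose X j : padic_int p_pr := if j == i then Y else (w j)%:~R.
exists (\row_j tofrac (X j)).
  apply/eqP => /rowP/(_ i)/eqP; rewrite !mxE tofrac_eq0 /X eqxx => /eqP Y0.
  have u0 : (p %| u)%Z.
    have /(congr1 (fun x : padic_int p_pr => x 1%N)) := Yu.
    rewrite Y0 expr0n eqn0Ngt d_gt0 mulr0 padic_intr /= expr1 mod0z.
    by move=> /esym u0; apply/dvdz_mod0P.
  have : (p %| (a 0 i * w i ^+ d)%R)%Z.
    rewrite -[_ * _](subrK u) rpredD //; apply: dvdz_trans uw.
    by rewrite exprS dvdz_mulr.
  rewrite dvdzE abszM abszX absz_nat Euclid_dvdM // Euclid_dvdX // d_gt0 andbT.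
  by rewrite !dvdzE !absz_nat in pai pwi; rewrite (negPf pai) (negPf pwi).
under eq_bigr => j _ do rewrite mxE -(rmorph_int (@tofrac _)) -rmorphXn -rmorphM.
rewrite -rmorph_sum /= (bigD1 i) //= {1}/X eqxx Yu.
have -> : \sum_(j | j != i) (a 0 j)%:~R * X j ^+ d = (- u)%:~R.
  rewrite opprK rmorph_sum; apply: eq_bigr => j ji.
  by rewrite /X (negPf ji) rmorphM rmorphXn.
by rewrite -rmorphD subrr rmorph0.
Qed.

Lemma intr_Fp_eq0 p (z : int) : prime p -> ((z%:~R : 'F_p) == 0) = (p %| z)%Z.
Proof.
move=> p_pr; rewrite dvdzE absz_nat (dvdn_pcharf (pchar_Fp p_pr)).
by case: z => m //; rewrite NegzE mulrNz oppr_eq0 -pmulrn abszN.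
Qed.

(** Coordinates outside i, j, k are set to 0 and the last of the three to 1.  As
    p > d, solubility modulo p already allows lifting. *)
Lemma soluble_padic_of_three_units (p d : nat) (p_pr : prime p)
    (a : 'rV[int]_4) (i j k : 'I_4) :
    (0 < d)%N -> (16 * d ^ 4 < p)%N -> [/\ i != j, i != k & j != k] ->
    ~~ (p %| a 0%R i)%Z -> ~~ (p %| a 0%R j)%Z -> ~~ (p %| a 0%R k)%Z ->
  soluble_over (padic p_pr) d a.
Proof.
move=> d_gt0 dp [ij ik jk] pai paj pak.
have d_lt_p : (d < p)%N.
  apply: leq_ltn_trans dp; apply: leq_trans (leq_pmull _ _) => //.
  by rewrite expnS leq_pmulr // expn_gt0 d_gt0.
have dp_Fp : (16 * d ^ 4 < #|'F_p|)%N by rewrite card_Fp.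
have [||| x [y [x0 xy]]] := diagonal_ternary_soluble 'F_p d (a 0 i)%:~R (a 0 j)%:~R
  (a 0 k)%:~R d_gt0 dp_Fp; rewrite ?intr_Fp_eq0 //.
pose w l : 'F_p := if l == i then x else if l == j then y else
  if l == k then 1 else 0.
have wE l : ((w l : nat)%:Z)%:~R = w l :> 'F_p by rewrite -pmulrn natr_Zp.
apply: (soluble_padic_of_mod p d p_pr a (fun l => (w l : nat)%:Z) i) => //.
  by rewrite -intr_Fp_eq0 // wE /w eqxx.
rewrite logn_coprime; last by rewrite prime_coprime // gtnNdvd.
rewrite double0 expr1 -intr_Fp_eq0 // rmorph_sum /=.
rewrite (bigD1 i) //= (bigD1 j) 1?eq_sym //= (bigD1 k) /=; last first.
  by rewrite ![k == _]eq_sym ik jk.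
rewrite big1 => [|l /andP[/andP[li lj] lk]]; rewrite rmorphM rmorphXn /= wE /w.
  rewrite !rmorphM !rmorphXn /= !wE /w eqxx [j == i]eq_sym (negPf ij) eqxx.
  rewrite ![k == _]eq_sym (negPf ik) (negPf jk) eqxx expr1n mulr1 addr0 addrA.
  by rewrite xy.
by rewrite (negPf li) (negPf lj) (negPf lk) expr0n gtn_eqF // mulr0.
Qed.

Lemma soluble_real_of_signs (R : realType) d (a : 'rV[int]_4) (i j : 'I_4) :
  (0 < d)%N -> 0 < a 0 i -> a 0 j < 0 -> soluble_over R d a.
Proof.
move=> d_gt0 ai aj.
have ij : j != i by apply: contraTneq aj => ->; rewrite -leNgt ltW.
pose s : R := - (a 0 j)%:~R / (a 0 i)%:~R.
have s0 : 0 <= s by apply: divr_ge0; rewrite ?oppr_ge0 ?ler0z ?lerz0 ltW.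
have [||t _ ts] := @poly_ivt R ('X^d - s%:P) 0 (1 + s).
- by rewrite addr_ge0.
- rewrite !hornerE expr0n gtn_eqF // sub0r oppr_le0 s0 subr_ge0.
  apply: (@le_trans _ _ (1 + s)); first by rewrite lerDr.
  by rewrite ler_eXnr // lerDl.
exists (\row_l if l == i then t else if l == j then 1 else 0).
  apply/eqP => /rowP/(_ j)/eqP; rewrite !mxE (negPf ij) eqxx.
  by rewrite oner_eq0.
rewrite (bigD1 i) //= (bigD1 j) //= big1 => [|l /andP[li lj]]; rewrite !mxE.
  rewrite eqxx (negPf ij) eqxx expr1n mulr1 addr0.
  move: ts; rewrite /root !hornerE subr_eq0 => /eqP->.
  by rewrite /s mulrC divfK ?addNr // intr_eq0 gt_eqF.
by rewrite (negPf li) (negPf lj) expr0n gtn_eqF // mulr0.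
Qed.

(** * Counting coprime tuples in an arithmetic progression *)

Lemma progression_mod_inj (p Q m n : nat) :
    coprime p Q -> (p %| Q * m + 1)%N -> (p %| Q * n + 1)%N ->
  (m = n %[mod p])%N.
Proof.
move=> pQ; wlog nm : m n / (n <= m)%N.
  by move=> wlog_nm pm pn; case: (leqP n m) => [|/ltnW] /wlog_nm ->.
move=> pm pn; apply/eqP; rewrite eqn_mod_dvd // -(Gauss_dvdr _ pQ) mulnBr.
by rewrite -(subnDr 1) dvdn_sub.
Qed.

(** Since Q is invertible modulo p, p divides Q m + 1 for at most one m in each
    block of p consecutive integers. *)
Lemma card_progression_multiples (N p Q : nat) :
    (0 < p)%N -> coprime p Q ->
  (#|[set m : 'I_N | (p %| Q * m + 1)%N]| <= (N %/ p).+1)%N.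
Proof.
move=> p_gt0 pQ; pose f (m : 'I_N) : 'I_(N %/ p).+1 := inord (m %/ p).
rewrite -[leqRHS]card_ord -(card_in_imset (f := f)) ?max_card // => m n.
have f_val (k : 'I_N) : f k = (k %/ p)%N :> nat.
  by rewrite inordK // ltnS leq_div2r // ltnW.
rewrite !inE => pm pn /(congr1 (@nat_of_ord _)); rewrite !f_val => mn.
apply: val_inj => /=; rewrite (divn_eq m p) (divn_eq n p) mn.
by rewrite (progression_mod_inj p Q m n).
Qed.

Definition common_factor_pairs (N Q : nat) : {set 'I_N * 'I_N} :=
  [set mn : 'I_N * 'I_N | ~~ coprime (Q * mn.1 + 1)%N (Q * mn.2 + 1)%N].

(** A common prime factor p of Q m + 1 and Q n + 1 is prime to Q, hence exceeds
    P; if m and n differ it divides m - n, so p < N.  The first term N counts the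
    diagonal. *)
Lemma card_common_factor_pairs_sum (N Q P : nat) :
    (forall p, prime p -> (p <= P)%N -> (p %| Q)%N) ->
  (#|common_factor_pairs N Q| <=
    N + \sum_(P.+1 <= p < N) (N %/ p).+1 ^ 2)%N.
Proof.
move=> small_p; pose S p := [set m : 'I_N | (p %| Q * m + 1)%N].
pose diag := [set mn : 'I_N * 'I_N | mn.1 == mn.2].
have card_diag : (#|diag| <= N)%N.
  rewrite -[leqRHS]card_ord -(card_in_imset (f := fst)) ?max_card //.
  by case=> [m m'] [n n']; rewrite !inE /= => /eqP <- /eqP <- ->.
pose I := [set p : 'I_N | (P < p)%N && coprime p Q].
have sub : common_factor_pairs N Q \subset
    diag :|: \bigcup_(p in I) setX (S p) (S p).
  apply/subsetP => -[m n]; rewrite !inE /= => mn.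
  have [//|m_neq_n] := eqVneq m n; rewrite orFb.
  set g := gcdn (Q * m + 1) (Q * n + 1) in mn.
  have g_gt1 : (1 < g)%N.
    by rewrite ltn_neqAle eq_sym mn gcdn_gt0 addn1.
  have p_pr := pdiv_prime g_gt1; set p := pdiv g in p_pr.
  have pm : (p %| Q * m + 1)%N := dvdn_trans (pdiv_dvd g) (dvdn_gcdl _ _).
  have pn : (p %| Q * n + 1)%N := dvdn_trans (pdiv_dvd g) (dvdn_gcdr _ _).
  have p_ndvd_Q : ~~ (p %| Q)%N.
    apply/negP => pQ; have := pm; rewrite dvdn_addr ?dvdn_mulr // dvdn1.
    by move/eqP => p1; rewrite p1 in p_pr.
  have pQ : coprime p Q by rewrite prime_coprime.
  have P_lt_p : (P < p)%N by rewrite ltnNge; apply: contra p_ndvd_Q => /small_p->.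
  have p_lt_N : (p < N)%N.
    rewrite ltnNge; apply: contra m_neq_n => N_le_p; apply/eqP/val_inj => /=.
    have := progression_mod_inj p Q m n pQ pm pn.
    by rewrite !modn_small // (leq_trans _ N_le_p).
  apply/bigcupP; exists (Ordinal p_lt_N); first by rewrite inE /= P_lt_p.
  by rewrite !inE /= pm pn.
apply: leq_trans (subset_leq_card sub) _.
apply: leq_trans (leq_card_setU _ _) (leq_add card_diag _).
apply: (@leq_trans (\sum_(p in I) #|setX (S p) (S p)|)).
  elim/big_ind2: _ => [|A a B b Aa Bb|//]; first by rewrite cards0.
  exact: leq_trans (leq_card_setU _ _) (leq_add Aa Bb).
rewrite big_geq_mkord [leqRHS](bigID (fun p : 'I_N => coprime p Q)) /=.
rewrite -[leqLHS]addn0 leq_add //.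
rewrite (eq_bigl (fun p : 'I_N => (P < p)%N && coprime p Q)); last first.
  by move=> p; rewrite inE.
apply: leq_sum => p /andP[P_lt_p pQ].
rewrite cardsX mulnn leq_sqr; apply: card_progression_multiples => //.
exact: leq_ltn_trans P_lt_p.
Qed.

(** The summand telescopes: 1 / (k (k - 1)) = 1 / (k - 1) - 1 / k. *)
Lemma sum_inv_pred_mul_le (F : realFieldType) (P N : nat) : (0 < P)%N ->
  \sum_(P.+1 <= k < N) (k * k.-1)%:R^-1 <= P%:R^-1 :> F.
Proof.
move=> P_gt0; have [N_le|P_lt_N] := leqP N P.+1.
  by rewrite big_geq // invr_ge0 ler0n.
rewrite (telescope_sumr_eq (fun k : nat => - (k.-1%:R : F)^-1)).
- by rewrite opprK addrC gerBl invr_ge0 ler0n.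
- exact: ltnW.
case=> [|[|k]] /andP[Pk _]; [by [] | by rewrite ltnNge P_gt0 in Pk |].
rewrite !succnK opprK addrC natrM.
have k1 : k.+1%:R != 0 :> F by rewrite pnatr_eq0.
have k2 : k.+2%:R != 0 :> F by rewrite pnatr_eq0.
by rewrite !mulrS in k1 k2 *; field; rewrite k2 k1.
Qed.

(** For p <= N the term is at most (2 N / p)^2, and the sum of 1 / p^2 over
    p > P is at most 1 / P. *)
Lemma sum_sqr_divn_le (N P : nat) :
  (0 < P)%N -> (P * \sum_(P.+1 <= p < N) (N %/ p).+1 ^ 2 <= 4 * N ^ 2)%N.
Proof.
move=> P_gt0; rewrite -(ler_nat rat) natrM natr_sum.
rewrite mulrC -ler_pdivlMr ?ltr0n //.
apply: le_trans (ler_wpM2l (ler0n _ _) (sum_inv_pred_mul_le rat P N P_gt0)).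
rewrite mulr_sumr big_nat [leRHS]big_nat ler_sum // => p /andP[P_lt_p p_lt_N].
have pp_gt0 : (0 < p * p.-1)%N by rewrite muln_gt0; lia.
rewrite ler_pdivlMr ?ltr0n // -natrM ler_nat.
have := leq_divM N p; set q := (N %/ p)%N => qp.
have qp2 : (q.+1 * p <= 2 * N)%N by lia.
apply: (@leq_trans ((q.+1 * p) ^ 2)).
  by rewrite expnMn leq_mul // -mulnn leq_mul // leq_pred.
by rewrite (leq_trans (_ : _ <= (2 * N) ^ 2)%N) ?leq_sqr // expnMn.
Qed.

Lemma card_common_factor_pairs_le (N Q P : nat) :
    (0 < P)%N ->
    (forall p, prime p -> (p <= P)%N -> (p %| Q)%N) ->
  (P * #|common_factor_pairs N Q| <= P * N + 4 * N ^ 2)%N.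
Proof.
move=> P_gt0 small_p; have B := card_common_factor_pairs_sum N Q P small_p.
apply: leq_trans (leq_mul (leqnn P) B) _.
by rewrite mulnDr leq_add2l sum_sqr_divn_le.
Qed.

Lemma card_ffun_two_values (I T : finType) (i j : I) (x y : T) : i != j ->
  #|[set m : {ffun I -> T} | (m i == x) && (m j == y)]| = (#|T| ^ #|I|.-2)%N.
Proof.
move=> ij; pose F k : pred T :=
  if k == i then pred1 x else if k == j then pred1 y else predT.
transitivity #|(family F : simpl_pred {ffun I -> T})|.
  apply: eq_card => m; apply/idP/familyP; rewrite inE.
    case/andP=> /eqP mi /eqP mj k; rewrite /F.
    by case: eqVneq => [->|_]; [|case: eqVneq => [->|_]]; rewrite inE ?mi ?mj.
  move=> mF; move: (mF i) (mF j).
  by rewrite /F eqxx [j == i]eq_sym (negPf ij) eqxx !inE => -> ->.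
rewrite card_family foldrE big_map big_enum /=.
rewrite (bigD1 i) //= (bigD1 j) /=; last by rewrite eq_sym.
rewrite {1 2}/F eqxx [j == i]eq_sym (negPf ij) eqxx !card1 !mul1n.
rewrite (eq_bigr (fun=> #|T|)) => [|k /andP[ki kj]]; last first.
  by rewrite /F (negPf ki) (negPf kj).
rewrite prod_nat_const; congr (_ ^ _)%N.
rewrite [in RHS](cardD1 i) [in RHS](cardD1 j) !inE eq_sym ij.
by apply: eq_card => k; rewrite !inE /= andbT andbC.
Qed.

Lemma card_ffun_pair_in (I T : finType) (i j : I) (B : {set T * T}) : i != j ->
  (#|[set m : {ffun I -> T} | (m i, m j) \in B]| = #|B| * #|T| ^ #|I|.-2)%N.
Proof.
move=> ij; rewrite -sum1dep_card.
rewrite (partition_big (fun m : {ffun I -> T} => (m i, m j)) (mem B)) //=.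
rewrite -sum_nat_const; apply: eq_bigr => -[x y] xyB.
rewrite -(card_ffun_two_values I T i j x y ij) -sum1dep_card.
apply: eq_bigl => m; rewrite xpair_eqE andbC.
by case: eqP => // ->; case: eqP => // ->; rewrite andbT xyB.
Qed.

Definition pairwise_coprime_tuples (N Q : nat) : {set {ffun 'I_4 -> 'I_N}} :=
  [set m : {ffun 'I_4 -> 'I_N} | [forall i, forall j, (i != j) ==>
    coprime (Q * m i + 1) (Q * m j + 1)]].

(** A union bound over the pairs of positions.  Each pair of positions excludes a
    proportion of at most 1 / N + 4 / P of the tuples, and the constants 64 and
    256 make 16 times this proportion at most 1 / 2. *)
Lemma card_pairwise_coprime_tuples (N Q P : nat) :
    (256 <= P)%N -> (64 <= N)%N ->
    (forall p, prime p -> (p <= P)%N -> (p %| Q)%N) ->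
  (N ^ 4 <= 2 * #|pairwise_coprime_tuples N Q|)%N.
Proof.
move=> P_ge N_ge small_p; set G := pairwise_coprime_tuples N Q.
have P_gt0 : (0 < P)%N by lia.
have B_le := card_common_factor_pairs_le N Q P P_gt0 small_p.
set B := common_factor_pairs N Q in B_le.
have GC_sub : ~: G \subset \bigcup_(ij : 'I_4 * 'I_4 | ij.1 != ij.2)
    [set m : {ffun 'I_4 -> 'I_N} | (m ij.1, m ij.2) \in B].
  apply/subsetP => m; rewrite !inE => /forallPn[i /forallPn[j]].
  rewrite negb_imply => /andP[ij mij].
  by apply/bigcupP; exists (i, j); rewrite // !inE.
have GC_le : (#|~: G| <= 16 * (#|B| * N ^ 2))%N.
  apply: leq_trans (subset_leq_card GC_sub) _.
  apply: (@leq_trans (\sum_(ij : 'I_4 * 'I_4 | ij.1 != ij.2)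
      #|[set m : {ffun 'I_4 -> 'I_N} | (m ij.1, m ij.2) \in B]|)).
    elim/big_ind2: _ => [|A a C c Aa Cc|//]; first by rewrite cards0.
    exact: leq_trans (leq_card_setU _ _) (leq_add Aa Cc).
  apply: (@leq_trans (\sum_(ij : 'I_4 * 'I_4) #|B| * N ^ 2)).
    rewrite big_mkcond leq_sum // => -[i j] _ /=; case: ifP => // ij.
    by rewrite card_ffun_pair_in // !card_ord.
  by rewrite sum_nat_const card_prod !card_ord.
have GT : (#|G| + #|~: G| = N ^ 4)%N by rewrite cardsC card_ffun !card_ord.
have B16 : (32 * #|B| <= N ^ 2)%N.
  rewrite -(leq_pmul2l P_gt0); move: B_le N_ge P_ge; rewrite -!mulnn.
  move: #|B| => b; nia.
have GC2 : (2 * #|~: G| <= N ^ 4)%N.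
  have -> : (N ^ 4 = N ^ 2 * N ^ 2)%N by rewrite -expnD.
  apply: leq_trans (leq_mul B16 (leqnn _)).
  by apply: leq_trans (leq_mul (leqnn 2) GC_le) _; rewrite !mulnA.
lia.
Qed.

(** * Soluble coefficient vectors *)

(** The factor d^2 provides p^(2 v_p(d)) and the factorial one more power of each
    prime p <= P, so that hensel_diagonal applies modulo this number. *)
Definition small_prime_modulus (d P : nat) : nat := (d ^ 2 * P`!)%N.

Lemma small_prime_modulus_gt0 d P : (0 < d)%N -> (0 < small_prime_modulus d P)%N.
Proof. by move=> d_gt0; rewrite muln_gt0 expn_gt0 d_gt0 fact_gt0. Qed.

Lemma dvdn_small_prime_modulus d P p : prime p -> (p <= P)%N ->
  (p ^ (logn p d).*2.+1 %| small_prime_modulus d P)%N.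
Proof.
move=> p_pr pP; rewrite expnSr -muln2 expnM.
by rewrite dvdn_mul ?dvdn_exp2r ?pfactor_dvdnn ?dvdn_fact ?prime_gt0.
Qed.

(** The single negative sign, in the second position, serves real solubility and
    makes the first two entries cancel modulo Q. *)
Definition progression_coeffs (N Q : nat) (m : {ffun 'I_4 -> 'I_N}) : 'rV[int]_4 :=
  \row_i ((-1) ^+ (i == lift ord0 ord0) * (Q * m i + 1)%:Z).

Lemma dvdz_progression_coeffs (N Q p : nat) (m : {ffun 'I_4 -> 'I_N}) i :
  (p %| progression_coeffs N Q m 0%R i)%Z = (p %| Q * m i + 1)%N.
Proof. by rewrite mxE dvdzE abszMsign !absz_nat. Qed.

Lemma progression_coeffs_soluble (R : realType) (N d P : nat)
    (m : {ffun 'I_4 -> 'I_N}) :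
    (0 < d)%N -> (16 * d ^ 4 <= P)%N ->
    m \in pairwise_coprime_tuples N (small_prime_modulus d P) ->
  everywhere_locally_soluble R d (progression_coeffs N (small_prime_modulus d P) m).
Proof.
move=> d_gt0 dP; set Q := small_prime_modulus d P.
rewrite inE => /'forall_'forall_implyP m_coprime.
set a := progression_coeffs N Q m; pose i1 : 'I_4 := lift ord0 ord0.
have i1_neq0 : i1 != 0 by [].
have a0 : a 0 0 = (Q * m 0 + 1)%:Z by rewrite mxE mul1r.
have a1 : a 0 i1 = - (Q * m i1 + 1)%:Z by rewrite mxE eqxx mulN1r.
split=> [|p p_pr].
  apply: (@soluble_real_of_signs R d a 0 i1) => //.
    by rewrite a0 addn1.
  by rewrite a1 addn1.
have [pP|Pp] := leqP p P.
  have pQ := dvdn_small_prime_modulus d P p p_pr pP.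
  (* The approximate solution (1, 1, 0, 0). *)
  pose w (i : 'I_4) : int := (i == 0) || (i == i1).
  have p_ndvd1 : ~~ (p %| 1)%N by rewrite dvdn1 gtn_eqF ?prime_gt1.
  apply: (@soluble_padic_of_mod p d p_pr a w 0) => //.
    rewrite dvdz_progression_coeffs dvdn_addr // dvdn_mulr //.
    by apply: dvdn_trans pQ; rewrite dvdn_exp.
  have -> : \sum_j a 0 j * w j ^+ d = Q%:Z * ((m 0)%:Z - (m i1)%:Z).
    rewrite (bigD1 0) //= (bigD1 i1) //= big1 => [|j /andP[j0 j1]]; last first.
      by rewrite /w (negPf j0) (negPf j1) expr0n gtn_eqF // mulr0.
    rewrite /w !eqxx orbT !expr1n a0 a1 !PoszD !PoszM; ring.
  by rewrite dvdz_mulr // dvdzE abszX !absz_nat.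
(* At most one entry is divisible by p; the other three are units. *)
have [l p_off_l] : exists l, forall i, i != l -> ~~ (p %| a 0%R i)%Z.
  case: (pickP (fun l => (p %| a 0%R l)%Z)) => [l pl|none]; last first.
    by exists 0 => i _; rewrite none.
  exists l => i il; apply/negP; move: pl; rewrite !dvdz_progression_coeffs => pl pi.
  have : (p %| 1)%N by rewrite -(eqP (m_coprime i l il)) dvdn_gcd pi pl.
  by rewrite dvdn1 gtn_eqF ?prime_gt1.
apply: (soluble_padic_of_three_units p d p_pr a
  (lift l 0) (lift l 1) (lift l (1 + 1))) => //.
- exact: leq_ltn_trans Pp.
- by split; rewrite (inj_eq lift_inj).
- by apply: p_off_l; rewrite eq_sym neq_lift.
- by apply: p_off_l; rewrite eq_sym neq_lift.
- by apply: p_off_l; rewrite eq_sym neq_lift.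
Qed.

Lemma soluble_over_0 (K : fieldType) d : soluble_over K d 0.
Proof.
exists (const_mx 1); last by rewrite big1 // => i _; rewrite !mxE mul0r.
by apply/eqP => /rowP/(_ 0)/eqP; rewrite !mxE oner_eq0.
Qed.

Lemma M_gt0 (R : realType) d (H : R) : 0 <= H -> (0 < M_ d H)%N.
Proof.
move=> H0; rewrite cardfs_gt0; apply/fset0Pn; exists 0.
rewrite in_fset_set ?inE; last exact: soluble_coeffs_finite.
apply/asboolP; split=> [i|]; first by rewrite mxE normr0.
by split=> [|p p_pr]; apply: soluble_over_0.
Qed.

Lemma leq_M_of_inj (R : realType) (T : finType) (G : {set T}) (f : T -> 'rV[int]_4)
    d (H : R) :
    injective f -> {in G, forall m, soluble_coeffs d H (f m)} ->
  (#|G| <= M_ d H)%N.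
Proof.
move=> f_inj fG; have -> : #|G| = #|` [fset f m | m in G]%fset|.
  by rewrite card_imfset //= cardE; congr size.
apply/fsubset_leq_card/fsubsetP => _ /imfsetP[m /= mG ->].
rewrite in_fset_set ?inE; last exact: soluble_coeffs_finite.
by apply/asboolP/fG.
Qed.

Theorem theorem2 (R : realType) (d : nat) (d_ge1 : (1 <= d)%N) :
  exists2 c : R, 0 < c & forall H : R, 1 <= H -> c * H ^+ 4 <= (M_ d H)%:R.
Proof.
pose P := (256 * d ^ 4)%N; pose Q := small_prime_modulus d P.
have d4_gt0 : (0 < d ^ 4)%N by rewrite expn_gt0 d_ge1.
have P_ge256 : (256 <= P)%N by rewrite leq_pmulr.
have P_ge : (16 * d ^ 4 <= P)%N by rewrite leq_mul2r orbT.
have Q_gt0 : (0 < Q)%N by apply: small_prime_modulus_gt0.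
have Q_gt0R : 0 < Q%:R :> R by rewrite ltr0n.
have Q64_gt0 : 0 < 64 * Q%:R :> R by rewrite mulr_gt0.
(* With this constant the bound is at most 1 when H < 64 Q, and H >= 64 Q is
   what makes N >= 64. *)
exists ((64 * Q%:R) ^- 4); first by rewrite invr_gt0 exprn_gt0.
move=> H H_ge1; have H_ge0 : 0 <= H := le_trans ler01 H_ge1.
rewrite mulrC -expr_div_n.
have HQ_ge0 : 0 <= H / (64 * Q%:R) by rewrite divr_ge0 // ltW.
have [H_small|H_large] := ltP H (64 * Q%:R).
  apply: (@le_trans _ _ 1); last by rewrite ler1n M_gt0.
  by rewrite exprn_ile1 // ler_pdivrMr // mul1r ltW.
pose N := Num.truncn (H / Q%:R).
have HQ : 0 <= H / Q%:R by rewrite divr_ge0 // ltW.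
have N_le : N%:R * Q%:R <= H by rewrite -ler_pdivlMr // truncn_le.
have N_ge : (64 <= N)%N by rewrite truncn_ge_nat // ler_pdivlMr.
have N_gt : H / Q%:R < N.+1%:R by rewrite truncnS_gt.
have G_large : (N ^ 4 <= 2 * #|pairwise_coprime_tuples N Q|)%N.
  apply: (card_pairwise_coprime_tuples N Q P) => //.
  move=> p p_pr pP; apply: dvdn_trans (dvdn_small_prime_modulus d P p p_pr pP).
  by rewrite dvdn_exp.
have G_le : (#|pairwise_coprime_tuples N Q| <= M_ d H)%N.
  apply: (leq_M_of_inj R _ _ (progression_coeffs N Q)).
    move=> m n /rowP mn; apply/ffunP => i; apply: val_inj => /=.
    have := mn i; rewrite !mxE => /(mulfI _) mi_eq.
    have /mi_eq[] : (-1) ^+ (i == lift ord0 ord0) != 0 :> int by rewrite signr_eq0.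
    by rewrite !addn1 => -[] /eqP; rewrite eqn_pmul2l // => /eqP.
  move=> m mG; split=> [i|]; last first.
    exact: progression_coeffs_soluble.
  rewrite mxE normrM normr_sign mul1r -pmulrn; apply: le_trans N_le.
  rewrite -natrM ler_nat; apply: (@leq_trans ((m i).+1 * Q)).
    by rewrite mulSn addnC mulnC leq_add2r.
  by rewrite leq_mul2r ltn_ord orbT.
have N1_le : N.+1%:R <= 2 * N%:R :> R.
  by rewrite -natrM ler_nat mul2n -addnn -addn1 leq_add2l (leq_trans _ N_ge).
have H_le : H / (64 * Q%:R) <= N%:R / 32.
  have -> : H / (64 * Q%:R) = (H / Q%:R) / 64 by field; rewrite gt_eqF.
  have -> : N%:R / 32 = (2 * N%:R) / 64 :> R by field.
  by rewrite ler_wpM2r ?invr_ge0 // (le_trans (ltW N_gt)).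
apply: le_trans (_ : (N%:R / 32) ^+ 4 <= _).
  by rewrite lerXn2r // nnegrE // divr_ge0.
rewrite expr_div_n ler_pdivrMr ?exprn_gt0 // -[N%:R ^+ 4]natrX.
apply: (@le_trans _ _ (2 * (M_ d H)%:R)).
  by rewrite -natrM ler_nat (leq_trans G_large) // leq_mul2l.
rewrite mulrC ler_wpM2l // (@le_trans _ _ 32) ?ler_nat // ler_eXnr //.
by rewrite ler1n.
Qed.
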